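(* For every positive integer $k\leq 10$, there is no tournament $T$ having two distinct minimal $\tau$-retentive sets $R_1$ and $R_2$ with $|R_1|=5$ and $|R_2|=k$.
   Context: A tournament $T$ consists of a finite vertex set $V(T)$ and an asymmetric, complete binary relation $\succ$ on $V(T)$ ($x$ dominates $y$ if $x\succ y$). For $v\in V(T)$ let $N^-_T(v)=\{u\in V(T): u\succ v\}$; for $B\subseteq V(T)$, $T[B]$ is the induced subtournament. The tournament equilibrium set $\tau$ is defined recursively: a nonempty $A\subseteq V(T)$ is $\tau$-retentive if for every $v\in A$ with $N^-_T(v)\neq\emptyset$, $\tau(T[N^-_T(v)])\subseteq A$; $A$ is a minimal $\tau$-retentive set if no $\tau$-retentive set of $T$ is a proper subset of $A$; $\tau(T)$ is the union of all minimal $\tau$-retentive sets of $T$. *)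

(* Defs.v *)
From mathcomp Require Import all_boot.

Set Implicit Arguments.
Unset Strict Implicit.
Unset Printing Implicit Defensive.

Record tournament := Tournament {
  vertex :> finType;
  dom : rel vertex;
  dom_asym : forall x y, dom x y -> ~~ dom y x;
  dom_complete : forall x y, x != y -> dom x y || dom y x }.

Section TournamentEquilibriumSet.

Variable T : tournament.
Implicit Types (A B : {set T}) (v : T) (f : {set T} -> {set T}).

(* An induced subtournament T[B] is represented by its vertex set B, since its
   dominance relation is the restriction of the one of T; T itself is [set: T].
   Accordingly dominators B v is the set N^-_{T[B]}(v), and it also represents
   the tournament T[B][N^-_{T[B]}(v)]. *)
Definition dominators B v : {set T} := [set u in B | dom u v].

(* A is f-retentive in T[B], for a tournament solution f. *)
Definition retentive_for f B A : bool :=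
  [&& A != set0, A \subset B
    & [forall v in A, (dominators B v != set0)
                        ==> (f (dominators B v) \subset A)]].

(* The recursion defining tau is on the number of vertices, which bounds the
   depth n; tauE below is the defining equation. *)
Fixpoint tau_rec n B : {set T} :=
  if n is m.+1 then \bigcup_(A | minset (retentive_for (tau_rec m) B) A) A
  else set0.

Definition tau B : {set T} := tau_rec #|B| B.

Definition retentive B A : bool := retentive_for tau B A.

Definition minimal_retentive B A : bool := minset (retentive B) A.

Lemma dominators_proper B v : v \in B -> dominators B v \proper B.
Proof.
move=> vB; apply/properP; split.
  by apply/subsetP=> u; rewrite inE => /andP[].
exists v => //; rewrite inE vB /=; apply/negP => vv.
by move: (dom_asym vv); rewrite vv.
Qed.

Lemma eq_retentive_for f (g : {set T} -> {set T}) B :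
    (forall C : {set T}, C \proper B -> f C = g C) ->
  retentive_for f B =1 retentive_for g B.
Proof.
move=> fg A; rewrite /retentive_for; congr andb.
have [/subsetP sAB|//] := boolP (A \subset B).
apply: eq_forallb_in => v vA; rewrite fg //.
exact/dominators_proper/sAB.
Qed.

Lemma retentive_for_set0 f A : retentive_for f set0 A = false.
Proof. by rewrite /retentive_for subset0; case: eqP. Qed.

Lemma tau_rec_set0 n : tau_rec n set0 = set0.
Proof.
case: n => //= n; rewrite big_pred0 // => A; apply/negP => /minsetp.
by rewrite retentive_for_set0.
Qed.

Lemma tau_rec_stable n B : #|B| <= n -> tau_rec n B = tau B.
Proof.
rewrite /tau.
suff H m : forall k (C : {set T}), #|C| <= m -> #|C| <= k -> tau_rec m C = tau_rec k C.
  by move=> leBn; apply: H.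
elim: m => [|m IHm] k C.
  by rewrite leqn0 cards_eq0 => /eqP-> _; rewrite !tau_rec_set0.
case: k => [|k] leCm leCk.
  by move: leCk; rewrite leqn0 cards_eq0 => /eqP->; rewrite !tau_rec_set0.
apply: eq_bigl => A /=; apply/minset_eq/eq_retentive_for => D /proper_card ltDC.
by apply: IHm; rewrite -ltnS; apply: leq_trans ltDC _.
Qed.

Lemma tauE B : tau B = \bigcup_(A | minimal_retentive B A) A.
Proof.
rewrite -(tau_rec_stable (leqnSn #|B|)) /=; apply: eq_bigl => A.
apply/minset_eq/eq_retentive_for => C /proper_card /ltnW.
exact: tau_rec_stable.
Qed.

Lemma retentiveP B A :
  reflect [/\ A != set0, A \subset B
            & forall v, v \in A -> dominators B v != set0 ->
                tau (dominators B v) \subset A]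
          (retentive B A).
Proof.
apply: (iffP and3P) => -[A0 sAB /= tA]; split=> //.
  by move=> v vA; move/forall_inP: tA => /(_ v vA)/implyP.
by apply/forall_inP => v vA; apply/implyP/tA.
Qed.

End TournamentEquilibriumSet.

(* Main.v *)
(* For a vertex x outside a minimal retentive set A, the dominators of x in A
   form a hitting set of A: a set S such that, for every v in A outside S, the
   part of S in N^-(v) hits every minimal retentive set of N^-(v). The key fact is
   that disjoint hitting sets of A both have more than 4 elements.

   Let |R1| = 5. At most one vertex a of R1 has tau(N^-(a)) not a singleton; if
   tau(N^-(x)) = {y}, no vertex dominates both x and y, so the dominators of x and
   of y are disjoint hitting sets of R2. Every vertex of R1 belongs to such a pair,
   hence has at least 5 dominators in R2, and as |R2| <= 10 the dominators of x and
   y in R2 are complementary. As R1 is minimal, these pairs connect it, so two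
   vertices w, w' of R2 have complementary dominator sets in R1: two disjoint
   hitting sets of a set of 5 vertices, a contradiction. *)

Require Import Defs.
From mathcomp Require Import all_boot.

Set Implicit Arguments.
Unset Strict Implicit.
Unset Printing Implicit Defensive.

Section MinimalRetentiveSets.

Variable T : tournament.
Implicit Types (A B C S X : {set T}) (u v x y z : T).

(** * Elementary properties of minimal retentive sets *)

Lemma dom_irrefl x : dom x x = false.
Proof. by apply/negP => xx; move: (dom_asym xx); rewrite xx. Qed.

Lemma dom_asymF x y : dom x y -> dom y x = false.
Proof. by move=> /dom_asym/negbTE. Qed.

Lemma tau_sub X : tau X \subset X.
Proof.
rewrite tauE; apply/bigcupsP => A /minsetp /retentiveP[].
by move=> _ ->.
Qed.

Lemma minimal_retentive_exists X :
  X != set0 -> exists A, minimal_retentive X A.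
Proof.
move=> X0; have rX : retentive X X.
  apply/retentiveP; split=> // v _ _.
  apply: subset_trans (tau_sub _) _.
  by apply/subsetP => u; rewrite inE => /andP[].
by have [A] := minset_exists rX; exists A.
Qed.

Lemma minimal_retentive_neq0 X A : minimal_retentive X A -> A != set0.
Proof. by move=> /minsetp /retentiveP[]. Qed.

Lemma minimal_retentive_sub X A : minimal_retentive X A -> A \subset X.
Proof. by move=> /minsetp /retentiveP[]. Qed.

Lemma tau_neq0 X : X != set0 -> tau X != set0.
Proof.
move=> /minimal_retentive_exists[A mA]; have /set0Pn[x xA] := minimal_retentive_neq0 mA.
by apply/set0Pn; exists x; rewrite tauE; apply/bigcupP; exists A.
Qed.

Lemma minimal_retentive_tau X A v :
  minimal_retentive X A -> v \in A -> tau (dominators X v) \subset A.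
Proof.
move=> /minsetp /retentiveP[_ _ tA] vA.
have [->|] := eqVneq (dominators X v) set0; last exact: tA.
by apply: subset_trans (tau_sub _) (sub0set _).
Qed.

Lemma minimal_retentive_dominators X A v C :
  minimal_retentive X A -> v \in A -> minimal_retentive (dominators X v) C ->
  C \subset A.
Proof.
move=> mA vA mC; apply: subset_trans (minimal_retentive_tau mA vA).
by rewrite tauE; apply: bigcup_sup.
Qed.

Lemma card_dominators_lt X A v n :
  minimal_retentive X A -> v \in A -> #|X| < n.+1 -> #|dominators X v| < n.
Proof.
move=> /minimal_retentive_sub/subsetP sAX /sAX vX leXn.
exact: leq_trans (proper_card (dominators_proper vX)) leXn.
Qed.

(** A nonempty intersection would itself be retentive, hence equal to both sets by minimality. *)
Lemma minimal_retentive_disjoint X A B :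
  minimal_retentive X A -> minimal_retentive X B -> A != B ->
  forall x, x \in A -> x \notin B.
Proof.
move=> mA mB neqAB x xA; apply/negP => xB; case/eqP: neqAB.
have rAB : retentive X (A :&: B).
  apply/retentiveP; split.
  - by apply/set0Pn; exists x; rewrite inE xA.
  - by apply: subset_trans (subsetIl _ _) (minimal_retentive_sub mA).
  move=> v; rewrite inE => /andP[vA vB] _.
  by rewrite subsetI !(minimal_retentive_tau _ _).
by rewrite -(minsetinf mA rAB (subsetIl _ _)) (minsetinf mB rAB (subsetIr _ _)).
Qed.

Lemma minimal_retentive_undominated X A x :
  minimal_retentive X A -> x \in A -> dominators X x = set0 -> A = [set x].
Proof.
move=> mA xA Nx0; apply/esym/(minsetinf mA); last by rewrite sub1set.
apply/retentiveP; split=> [||v].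
- by apply/set0Pn; exists x; rewrite set11.
- by rewrite sub1set (subsetP (minimal_retentive_sub mA)).
by rewrite inE => /eqP ->; rewrite Nx0 eqxx.
Qed.

(** Otherwise removing [x] would leave a smaller retentive set. *)
Lemma minimal_retentive_in_tau X A x :
    minimal_retentive X A -> x \in A -> 1 < #|A| ->
  exists2 v, v \in A :\ x & x \in tau (dominators X v).
Proof.
move=> mA xA A_gt1.
have [/exists_inP[v vA xv]|noV] :=
  boolP [exists v in A :\ x, x \in tau (dominators X v)]; first by exists v.
suff rAx : retentive X (A :\ x).
  by have /setP/(_ x) := minsetinf mA rAx (subsetDl _ _); rewrite !inE eqxx xA.
apply/retentiveP; split=> [||v vAx _].
- by rewrite -card_gt0; move: A_gt1; rewrite (cardsD1 x) xA.
- by apply: subset_trans (subsetDl _ _) (minimal_retentive_sub mA).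
have vA : v \in A by move: vAx; rewrite inE => /andP[].
rewrite subsetD1 (minimal_retentive_tau mA vA) /=.
by apply: contra noV => xv; apply/exists_inP; exists v.
Qed.

Lemma minimal_retentive_dominates X A x :
  minimal_retentive X A -> x \in A -> 1 < #|A| -> exists2 v, v \in A & dom x v.
Proof.
move=> mA xA /(minimal_retentive_in_tau mA xA)[v].
rewrite inE => /andP[_ vA] /(subsetP (tau_sub _)); rewrite inE => /andP[_ xv].
by exists v.
Qed.

Lemma minimal_retentive_dominated X A x :
  minimal_retentive X A -> x \in A -> 1 < #|A| -> exists2 v, v \in A & dom v x.
Proof.
move=> mA xA A_gt1.
have [Nx0|] := eqVneq (dominators X x) set0.
  by move: A_gt1; rewrite (minimal_retentive_undominated mA xA Nx0) cards1.
move=> /tau_neq0/set0Pn[v vt]; exists v.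
  exact: subsetP (minimal_retentive_tau mA xA) _ vt.
by move: (subsetP (tau_sub _) _ vt); rewrite inE => /andP[].
Qed.

(** Following dominators inside [A] from [x] to [y] to [z] gives three distinct vertices, by
    asymmetry. *)
Lemma minimal_retentive_gt2 X A : minimal_retentive X A -> 1 < #|A| -> 2 < #|A|.
Proof.
move=> mA A_gt1; have /set0Pn[x xA] := minimal_retentive_neq0 mA.
have [y yA yx] := minimal_retentive_dominated mA xA A_gt1.
have [z zA zy] := minimal_retentive_dominated mA yA A_gt1.
have nxy : x != y by apply: contraTneq yx => ->; rewrite dom_irrefl.
have nzy : z != y by apply: contraTneq zy => ->; rewrite dom_irrefl.
have nzx : z != x by apply: contraTneq zy => ->; rewrite (dom_asymF yx).
apply: leq_trans (_ : #|[set z; x; y]| <= _).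
  by rewrite -setUA cardsU1 !inE negb_or nzx nzy cards2 nxy.
by apply/subset_leq_card/subsetP => t; rewrite !inE => /orP[/orP[]|] /eqP->.
Qed.

(** * Hitting sets *)

(* The clause [dominators X v != set0]
   prevents a source of A outside S from being hit vacuously. *)
Inductive hits S X A : Prop := Hits of minimal_retentive X A
  & (forall v, v \in A -> v \notin S -> dominators X v != set0)
  & (forall v C, v \in A -> v \notin S ->
       minimal_retentive (dominators X v) C -> hits S (dominators X v) C).

Lemma hits_nonempty S X A : hits S X A -> exists2 x, x \in A & x \in S.
Proof.
have [n] := ubnP #|X|; elim: n X A => [//|n IHn] X A ltXn [mA Nn0 hA].
have /set0Pn[x xA] := minimal_retentive_neq0 mA.
have [xS|xS] := boolP (x \in S); first by exists x.
have [C mC] := minimal_retentive_exists (Nn0 x xA xS).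
have [|y yC yS] := IHn _ _ _ (hA x C xA xS mC).
  exact: card_dominators_lt mA xA ltXn.
by exists y => //; apply: subsetP yC; apply: minimal_retentive_dominators mC.
Qed.

(** Only the part of [S] in [A] matters: every minimal retentive set met in the recursion lies in
    [A]. *)
Lemma hits_mono S S' X A : hits S X A -> S :&: A \subset S' -> hits S' X A.
Proof.
have [n] := ubnP #|X|; elim: n X A => [//|n IHn] X A ltXn [mA Nn0 hA] sSS'.
have notS v : v \in A -> v \notin S' -> v \notin S.
  move=> vA; apply: contra => vS; apply: (subsetP sSS').
  by rewrite inE vS vA.
split=> [//|v vA vS'|v C vA vS' mC]; first exact/Nn0/notS.
apply: IHn; first exact: card_dominators_lt mA vA ltXn.
  by apply: hA => //; apply: notS.
by apply: subset_trans (setIS _ _) sSS'; apply: minimal_retentive_dominators mC.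
Qed.

(** If [v] in [A] does not dominate [x], then [x] is in N^-(v), and it stays outside every minimal
    retentive set of N^-(v), as these lie in [A]. Induction applies there. *)
Lemma hits_outside X A x :
  minimal_retentive X A -> x \in X :\: A -> hits [set u | dom u x] X A.
Proof.
have [n] := ubnP #|X|; elim: n X A => [//|n IHn] X A ltXn mA; rewrite inE => /andP[xA xX].
have domx v : v \in A -> v \notin [set u | dom u x] -> x \in dominators X v.
  move=> vA; rewrite !inE xX /= => vx.
  have /dom_complete : v != x by apply: contraNneq xA => <-.
  by rewrite (negbTE vx).
split=> [//|v vA vx|v C vA vx mC]; first by apply/set0Pn; exists x; apply: domx.
apply: (IHn _ _ _ mC); first exact: card_dominators_lt mA vA ltXn.
rewrite inE domx // andbT; apply: contra xA; apply/subsetP.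
exact: minimal_retentive_dominators mC.
Qed.

Lemma hits_dominator S X A u :
  hits S X A -> u \in A -> u \notin S -> exists2 s, s \in S :&: A & dom s u.
Proof.
move=> [mA Nn0 hA] uA uS; have [C mC] := minimal_retentive_exists (Nn0 u uA uS).
have [s sC sS] := hits_nonempty (hA _ _ uA uS mC); exists s.
  by rewrite inE sS (subsetP (minimal_retentive_dominators mA uA mC)).
by move: (subsetP (minimal_retentive_sub mC) _ sC); rewrite inE => /andP[].
Qed.

(** Take [C] minimal retentive in N^-(u). If [z] is in [C], a dominator of [z] in [S :&: C] works.
    If not, the dominators of [z] hit [C]; were none of them in [S :&: C], the complement of [S]
    would hit [C] too. The second hypothesis, which excludes this, will come from an induction. *)
Lemma hits_common_dominator S X A u z :
    hits S X A ->
    (forall C, minimal_retentive (dominators X u) C ->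
       hits S (dominators X u) C -> ~ hits (~: S) (dominators X u) C) ->
    u \in A -> u \notin S -> z \in A -> z \notin S -> dom z u ->
  exists2 s, s \in S :&: A & dom s u && dom s z.
Proof.
move=> [mA Nn0 hA] noC uA uS zA zS zu.
have [C mC] := minimal_retentive_exists (Nn0 u uA uS).
have hC := hA _ _ uA uS mC; have sCA := minimal_retentive_dominators mA uA mC.
have sCu s : s \in C -> dom s u.
  by move=> /(subsetP (minimal_retentive_sub mC)); rewrite inE => /andP[].
have [zC|zC] := boolP (z \in C).
  have [s] := hits_dominator hC zC zS; rewrite inE => /andP[sS sC] sz.
  by exists s; rewrite ?sz ?sCu // inE sS (subsetP sCA).
have [/exists_inP[s]|nos] := boolP [exists s in S :&: C, dom s z].
  rewrite inE => /andP[sS sC] sz.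
  by exists s; rewrite ?sz ?sCu // inE sS (subsetP sCA).
case: (noC C mC hC); apply: hits_mono (hits_outside mC (_ : z \in _)) _.
  by rewrite !inE zC zu (subsetP (minimal_retentive_sub mA)).
apply/subsetP => s; rewrite !inE => /andP[sz sC]; apply: contra nos => sS.
by apply/exists_inP; exists s; rewrite // inE sS.
Qed.

(** * Complementary hitting sets *)

Lemma card_le4_cover (B : {set T}) : B != set0 -> #|B| <= 4 ->
  exists a b c d, [/\ a \in B, b \in B, c \in B & d \in B] /\
    forall x, x \in B -> [|| x == a, x == b, x == c | x == d].
Proof.
(* The default [x0] lies in [B], so indices past the end still give elements of [B]; repetitions are
   harmless. *)
case/set0Pn => x0 x0B leB4; pose e i := nth x0 (enum B) i.
have eB i : e i \in B.
  have [lti|gei] := ltnP i (size (enum B)); last by rewrite /e nth_default.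
  by rewrite -mem_enum mem_nth.
exists (e 0), (e 1), (e 2), (e 3); split=> // x.
rewrite -mem_enum => /(nthP x0)[i]; rewrite -cardE => ltiB <-.
have : i < 4 := leq_trans ltiB leB4.
by case: i {ltiB} => [|[|[|[|//]]]] _; rewrite /e eqxx ?orbT.
Qed.

(* Colour S red and the rest of A blue, and suppose there are at most 4 red
   vertices. By induction no smaller set is hit by both colours, so any two
   vertices of the same colour have a common dominator of the other colour.
   Hence two blue vertices u, u' dominate two red vertices each, all of the red
   ones together, and there is no red common dominator of u and u'. *)
Lemma hits_setC_card S X A : hits S X A -> hits (~: S) X A -> 4 < #|S :&: A|.
Proof.
have [n] := ubnP #|X|; elim: n X A => [//|n IHn] X A ltXn hS hSC.
rewrite ltnNge; apply/negP => leS4; have [mA _ _] := hS.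
have noC u C : u \in A -> minimal_retentive (dominators X u) C ->
    hits S (dominators X u) C -> ~ hits (~: S) (dominators X u) C.
  move=> uA mC hC hCC; suff: 4 < #|S :&: C|.
    rewrite ltnNge (leq_trans _ leS4) //; apply/subset_leq_card/setIS.
    exact: minimal_retentive_dominators mC.
  by apply: IHn hC hCC; apply: card_dominators_lt mA uA ltXn.
have red2 s t : s \in S :&: A -> t \in S :&: A ->
    exists2 u, u \in ~: S :&: A & dom u s && dom u t.
  rewrite !inE => /andP[sS sA] /andP[tS tA].
  have [<-|/dom_complete nst] := eqVneq s t.
    have [|u uSA us] := hits_dominator hSC sA; first by rewrite inE sS.
    by exists u; rewrite ?us.
  wlog ts : s t sS sA tS tA {nst} / dom t s.
    move=> W; case/orP: nst => [st|ts]; last exact: W.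
    by have [u uSA] := W t s tS tA sS sA st; rewrite andbC; exists u.
  apply: (hits_common_dominator hSC) => //; rewrite ?inE ?sS ?tS // => C mC hC.
  by rewrite setCK => hC'; apply: noC sA mC hC' hC.
have S0 : S :&: A != set0.
  have [x xA xS] := hits_nonempty hS.
  by apply/set0Pn; exists x; rewrite inE xS.
have [a [b [c [d [[aS bS cS dS] cov]]]]] := card_le4_cover S0 leS4.
have [u] := red2 a b aS bS; rewrite !inE => /andP[uS uA] /andP[ua ub].
have [u'] := red2 c d cS dS; rewrite !inE => /andP[u'S u'A] /andP[u'c u'd].
have nored s : s \in S :&: A -> dom s u -> dom s u' -> False.
  by move=> /cov/or4P[]/eqP->; rewrite ?(dom_asymF ua) ?(dom_asymF ub)
    ?(dom_asymF u'c) ?(dom_asymF u'd).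
have [eu|/dom_complete/orP[uu'|u'u]] := eqVneq u u'.
- have [s sSA su] := hits_dominator hS uA uS.
  by apply: (nored s sSA su); rewrite -eu.
- have [s sSA /andP[su' su]] :=
    hits_common_dominator hS (noC u'^~ u'A) u'A u'S uA uS uu'.
  exact: nored sSA su su'.
- have [s sSA /andP[su su']] :=
    hits_common_dominator hS (noC u^~ uA) uA uS u'A u'S u'u.
  exact: nored sSA su su'.
Qed.


(** * Singleton values of tau on dominator sets *)

Lemma dominators_minimal1 X c : minimal_retentive X [set c] -> dominators X c = set0.
Proof.
move=> mc; apply/eqP; apply: contraT => /tau_neq0/set0Pn[z zt].
have := subsetP (minimal_retentive_tau mc (set11 c)) _ zt.
have := subsetP (tau_sub _) _ zt.
by rewrite !inE => /andP[_ zc] /eqP zE; rewrite zE dom_irrefl in zc.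
Qed.

(** As [c] is undominated in [X], a minimal retentive set avoiding [c] would be hit by the empty set
    of dominators of [c]. *)
Lemma tau_minimal1 X c : minimal_retentive X [set c] -> tau X = [set c].
Proof.
move=> mc; have Nc0 := dominators_minimal1 mc.
have cX : c \in X by rewrite -sub1set; apply: minimal_retentive_sub mc.
rewrite tauE (big_pred1 [set c]) // => C /=; apply/idP/eqP => [mC|-> //].
apply: (minimal_retentive_undominated mC) => //; apply: contraT => cC.
have [|y yC] := hits_nonempty (hits_outside mC (_ : c \in X :\: C)).
  by rewrite inE cC.
rewrite inE => yc; have /setP/(_ y) := Nc0.
by rewrite !inE yc (subsetP (minimal_retentive_sub mC)).
Qed.

(** Let [u] dominate [v]. Then [B] avoids both and has at least 3 elements, so it is all of
    [A :\ u :\ v]. If [u] is in [C], it dominates some element of [C], which lies in [B] and so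
    dominates [u]. Otherwise [C] is the same set as [B], and [v] dominates nothing in [A]. *)
Lemma large_dominator_set_unique X A u v B C :
    minimal_retentive X A -> #|A| <= 5 -> u \in A -> v \in A ->
    minimal_retentive (dominators X u) B -> 1 < #|B| ->
    minimal_retentive (dominators X v) C -> 1 < #|C| -> u = v.
Proof.
move=> mA leA5 uA vA mB B1 mC C1; apply/eqP; apply: contraT => nuv.
wlog uv : u v B C uA vA mB B1 mC C1 {nuv} / dom u v.
  move=> W; case/orP: (dom_complete nuv) => [uv|vu].
    exact: (W u v B C).
  exact: (W v u C B).
have A_gt1 : 1 < #|A|.
  by apply: leq_trans B1 _; apply/subset_leq_card/(minimal_retentive_dominators mA uA mB).
have nuv : u != v by apply: contraTneq uv => ->; rewrite dom_irrefl.
have card3 : #|A :\ u :\ v| <= 3.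
  by move: leA5; rewrite (cardsD1 u) uA (cardsD1 v) !inE eq_sym nuv vA.
have Eq (D : {set T}) z : minimal_retentive (dominators X z) D -> z \in A ->
    1 < #|D| -> u \notin D -> v \notin D -> D = A :\ u :\ v.
  move=> mD zA D1 uD vD; apply/eqP; rewrite eqEcard !subsetD1 uD vD.
  rewrite (minimal_retentive_dominators mA zA mD).
  by rewrite (leq_trans card3) // (minimal_retentive_gt2 mD).
have domz (D : {set T}) z : minimal_retentive (dominators X z) D ->
    forall c, c \in D -> dom c z.
  move=> mD c /(subsetP (minimal_retentive_sub mD)).
  by rewrite inE => /andP[].
have EB : B = A :\ u :\ v.
  apply: (Eq _ _ mB uA B1).
    by apply/negP => /(domz _ _ mB); rewrite dom_irrefl.
  by apply/negP => /(domz _ _ mB); rewrite (dom_asymF uv).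
have vC : v \notin C by apply/negP => /(domz _ _ mC); rewrite dom_irrefl.
have [uC|uC] := boolP (u \in C).
  have [c cC uc] := minimal_retentive_dominates mC uC C1.
  have: c \in B.
    rewrite EB !inE (subsetP (minimal_retentive_dominators mA vA mC)) // andbT.
    apply/andP; split; first by apply: contraNneq vC => <-.
    by apply: contraTneq uc => ->; rewrite dom_irrefl.
  by move=> /(domz _ _ mB); rewrite (dom_asymF uc).
have EC := Eq _ _ mC vA C1 uC vC.
have [w wA vw] := minimal_retentive_dominates mA vA A_gt1.
have: w \in C.
  rewrite EC !inE wA andbT; apply/andP; split.
    by apply: contraTneq vw => ->; rewrite dom_irrefl.
  by apply: contraTneq vw => ->; rewrite (dom_asymF uv).
by move=> /(domz _ _ mC); rewrite (dom_asymF vw).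
Qed.

Lemma minimal_retentive_single_tau A :
    minimal_retentive [set: T] A -> 1 < #|A| <= 5 ->
  exists2 a, a \in A & forall x, x \in A :\ a -> exists2 y, y \in A &
    tau (dominators [set: T] x) = [set y] /\ (forall w, dom w x -> ~~ dom w y).
Proof.
move=> mA /andP[A1 A5].
pose large x := [exists B : {set T},
  minimal_retentive (dominators [set: T] x) B && (1 < #|B|)].
have [a aA la] : exists2 a, a \in A & forall x, x \in A :\ a -> ~~ large x.
  have [/exists_inP[a aA /existsP[B /andP[mB B1]]]|nol] :=
    boolP [exists x in A, large x].
  - exists a => // x; rewrite !inE => /andP[nxa xA]; apply: contra nxa.
    case/existsP=> C /andP[mC C1]; apply/eqP.
    exact: (large_dominator_set_unique mA A5 xA aA mC C1 mB B1).
  (* With no large vertex, any element of [A] can serve as the exception. *)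
  - have /set0Pn[a aA] := minimal_retentive_neq0 mA.
    exists a => // x; rewrite !inE => /andP[_ xA]; apply: contra nol => lx.
    by apply/exists_inP; exists x.
exists a => // x xAa; have xA : x \in A by move: xAa; rewrite inE => /andP[].
have [v _ vx] := minimal_retentive_dominated mA xA A1.
have [|C mC] := @minimal_retentive_exists (dominators [set: T] x).
  by apply/set0Pn; exists v; rewrite !inE.
have /cards1P[y EC] : #|C| == 1.
  rewrite eqn_leq card_gt0 (minimal_retentive_neq0 mC) andbT leqNgt.
  by apply: contra (la x xAa) => C1; apply/existsP; exists C; rewrite mC.
rewrite {}EC in mC; exists y.
  by rewrite -sub1set; apply: minimal_retentive_dominators mC.
split=> [|w wx]; first exact: tau_minimal1.
apply/negP => wy; have /setP/(_ w) := dominators_minimal1 mC.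
by rewrite !inE wx wy.
Qed.

(** * The contradiction from two minimal retentive sets *)

Lemma no_two_minimal_retentive (R1 R2 : {set T}) :
    minimal_retentive [set: T] R1 -> minimal_retentive [set: T] R2 ->
    R1 != R2 -> 1 < #|R1| <= 5 -> #|R2| <= 10 -> False.
Proof.
move=> m1 m2 neq R1_5 R2_10; have R1_gt1 : 1 < #|R1| by case/andP: R1_5.
have dis := minimal_retentive_disjoint m1 m2 neq.
have [a aR partner] := minimal_retentive_single_tau m1 R1_5.
have pairP x : x \in R1 ->
    exists2 y, y \in R1 & forall w, dom w x -> ~~ dom w y.
  move=> xR; have [->|nxa] := eqVneq x a; last first.
    have [|y yR [_ yx]] := partner x; first by rewrite !inE nxa.
    by exists y.
  (* The exceptional [a] is itself the single element of tau(N^-(v)) for some other [v], and the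
     pair relation is symmetric. *)
  have [v vRa at_v] := minimal_retentive_in_tau m1 aR R1_gt1.
  have [y yR [tv vy]] := partner v vRa; move: at_v; rewrite tv inE => /eqP ay.
  exists v; first by move: vRa; rewrite inE => /andP[].
  by rewrite ay => w; apply: contraTN => /vy.
have hits2 x : x \in R1 -> hits [set w | dom w x] [set: T] R2.
  by move=> xR; apply: hits_outside => //; rewrite !inE dis.
have gt4 x : x \in R1 -> 4 < #|[set w | dom w x] :&: R2|.
  move=> xR; have [y yR yx] := pairP x xR.
  apply: hits_setC_card (hits2 x xR) (hits_mono (hits2 y yR) _).
  by apply/subsetP => w; rewrite !inE => /andP[wy _]; apply: contraTN wy => /yx.
have compl x y : x \in R1 -> y \in R1 -> (forall w, dom w x -> ~~ dom w y) ->
    forall w, w \in R2 -> dom w y = ~~ dom w x.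
  move=> xR yR xy w wR; apply/idP/idP => [|nwx]; first exact: contraTN (xy w).
  (* Two disjoint sets of at least 5 elements each fill [R2]. *)
  pose U := ([set w | dom w x] :|: [set w | dom w y]) :&: R2.
  have EU : U = R2.
    apply/eqP; rewrite eqEcard subsetIr (leq_trans R2_10) // /U setIUl cardsU.
    rewrite [X in _ - #|pred_of_set X|](_ : _ = set0) ?cards0 ?subn0.
      exact: leq_add (gt4 x xR) (gt4 y yR).
    apply/setP => z; rewrite !inE; have [/xy/negbTE->|] := boolP (dom z x) => //=.
    by rewrite andbF.
  by move: wR; rewrite -EU !inE (negbTE nwx) /= => /andP[].
(* [w] dominates [a], while [w'] dominates its partner [b] and hence not [a]: they disagree at
   [a]. *)
have [b bR ab] := pairP a aR.
have [w wR] := hits_nonempty (hits2 a aR); rewrite inE => wa.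
have [w' w'R] := hits_nonempty (hits2 b bR); rewrite inE => w'b.
have w'a : ~~ dom w' a by rewrite -(compl a b).
(* Z is retentive if nonempty, because dominator sets in R2 are complementary for
   x and y when tau(N^-(x)) = {y}; but it misses a. *)
pose Z := [set x in R1 | dom w x == dom w' x].
have Z0 x : x \notin Z.
  apply/negP => xZ; have aZ : a \notin Z by rewrite inE aR wa (negbTE w'a).
  have rZ : retentive [set: T] Z.
    apply/retentiveP; split=> // [|v]; first by apply/set0Pn; exists x.
    rewrite inE => /andP[vR vww'] _; have [|y yR [-> vy]] := partner v.
      by rewrite !inE vR andbT; apply: contraTneq vww' => ->; rewrite wa (negbTE w'a).
    by rewrite sub1set inE yR !(compl v y) // (eqP vww') /=.
  case/negP: aZ; rewrite (minsetinf m1 rZ) //.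
  by apply/subsetP => y; rewrite inE => /andP[].
have hits1 z : z \in R2 -> hits [set x | dom x z] [set: T] R1.
  by move=> zR; apply: hits_outside => //; rewrite !inE andbT; apply: contraL zR => /dis.
have domR x z : x \in R1 -> z \in R2 -> dom x z = ~~ dom z x.
  move=> xR zR; apply/idP/idP => [/dom_asym //|zx].
  have /dom_complete : x != z by apply: contraTneq zR => <-; apply: dis.
  by rewrite (negbTE zx) orbF.
have ww' x : x \in R1 -> dom x w = ~~ dom x w'.
  move=> xR; rewrite (domR x w) // (domR x w') //.
  by have := Z0 x; rewrite inE xR /=; case: (dom w x); case: (dom w' x).
have hC : hits (~: [set x | dom x w]) [set: T] R1.
  apply: hits_mono (hits1 w' w'R) _; apply/subsetP => x; rewrite !inE.
  by move=> /andP[xw' xR]; rewrite ww' ?xw'.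
have := hits_setC_card (hits1 w wR) hC.
(* More than 4 of at most 5 vertices would be all of [R1], but the complementary hitting set
   contains a vertex of [R1] too. *)
have [x xR] := hits_nonempty hC; rewrite !inE => xw.
rewrite ltnNge => /negP; apply; rewrite -ltnS.
apply: leq_trans (_ : #|R1| <= 5); last by case/andP: R1_5.
apply/proper_card/properP; split; first exact: subsetIr.
by exists x => //; rewrite !inE (negbTE xw).
Qed.

End MinimalRetentiveSets.

Theorem theorem5 (k : nat) (k_gt0 : 0 < k) (k_le10 : k <= 10) :
  ~ (exists (T : tournament) (R1 R2 : {set T}),
       [/\ minimal_retentive [set: T] R1, minimal_retentive [set: T] R2,
           R1 <> R2, #|R1| = 5 & #|R2| = k]).
Proof.
move=> [T [R1 [R2 [m1 m2 /eqP neq card1 card2]]]].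
by apply: (no_two_minimal_retentive m1 m2 neq); rewrite ?card1 ?card2.
Qed.
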